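(* For a disjunctively distributive lattice $\mathcal D$, let $P(\mathcal D)$ be the ordered topological space whose underlying set is the set $X_{\mathcal D}$ of disjunctive filters on $\mathcal D$, endowed with the topology generated by the sets $\{F\in X_{\mathcal D}: d\in F\}$ ($d\in\mathcal D$) and their complements in $X_{\mathcal D}$, and with the subset-inclusion order. For an arrow $f:\mathcal D\to\mathcal D'$ of $\mathbf{DJLat}$ let $P(f):X_{\mathcal D'}\to X_{\mathcal D}$ be $F\mapsto f^{-1}(F)$. Then $P$ is a functor $\mathbf{DJLat}^{\mathrm{op}}\to\mathbf{PTop}$, taking values in Priestley spaces, which yields a duality between $\mathbf{DJLat}$ and a subcategory of $\mathbf{PTop}$ (the extended image of $P$). Moreover: (1) A disjunctively distributive lattice $\mathcal D$ can be recovered (up to isomorphism) from $P(\mathcal D)$ as the set of those clopen upper sets $U$ such that any covering of $U$ by clopen upper sets admits a disjunctive refinement by clopen upper sets. (2) $\mathcal D$ can be recovered from the free Boolean algebra $B_{\mathcal D}$ on it as the set of those $\le$-upper elements $b$ (where $\le$ is the order on the Priestley space $P(\mathcal D)$, identified with $Spec(B_{\mathcal D})$) such that any finite covering of $b$ by $\le$-upper elements of $B_{\mathcal D}$ admits a disjunctive refinement by $\le$-upper elements.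
   Context: A disjunctively distributive lattice is a meet-semilattice (with top element) in which finite joins of pairwise disjoint elements exist (in particular the empty join $0$; two elements are disjoint if their meet is $0$) and distribute over finite meets. $\mathbf{DJLat}$ is the category of disjunctively distributive lattices and meet-semilattice homomorphisms (preserving the top) which preserve finite joins of pairwise disjoint elements. A disjunctive filter on $\mathcal D$ is a filter $F$ such that whenever the join of a finite family of pairwise disjoint elements belongs to $F$, some member of the family belongs to $F$ (in particular $0\notin F$). A covering of a clopen upper set $U$ by clopen upper sets is a family of clopen upper sets with union $U$; a disjunctive refinement of it is a family of pairwise disjoint clopen upper sets with union $U$, each contained in some member of the covering. Similarly, a finite covering of $b$ in a Boolean algebra is a finite family with join $b$, and a disjunctive refinement is a finite family of pairwise disjoint elements with join $b$, each below some member of the covering. The free Boolean algebra $B_{\mathcal D}$ on $\mathcal D$ is the Boolean algebra with a universal map $\mathcal D\to B_{\mathcal D}$ among meet-semilattice homomorphisms from $\mathcal D$ to Boolean algebras preserving finite joins of pairwise disjoint elements. Via restriction along the universal map the set $Spec(B_{\mathcal D})$ of prime filters of $B_{\mathcal D}$ is identified with $X_{\mathcal D}$. An element $b$ is $\le$-upper if for prime filters $G\le G'$, $b\in G$ implies $b\in G'$. $\mathbf{PTop}$: objects are triples $(X,\tau,\le)$ with $\tau$ a topology and $\le$ a preorder on $X$; arrows are continuous order-preserving maps. A Priestley space is a compact partially ordered topological space such that whenever $x\nleq y$ there is a clopen upper set containing $x$ and not $y$. The extended image of a functor $F:\mathcal U\to\mathcal V$ is the smallest subcategory of $\mathcal V$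 closed under isomorphisms in $\mathcal V$ through which $F$ factors. *)

(* Defs.v *)
From HB Require Import structures.
From mathcomp Require Import all_boot all_order.
From mathcomp Require Import all_classical.
From mathcomp Require Import topology.

Set Implicit Arguments.
Unset Strict Implicit.
Unset Printing Implicit Defensive.

Import Order.TTheory.
Local Open Scope classical_set_scope.

(** * Categories *)

Record category := Category {
  obj :> Type;
  Hom : obj -> obj -> Type;
  idm : forall A, Hom A A;
  cmp : forall A B C, Hom B C -> Hom A B -> Hom A C;
  cmp1m : forall A B (f : Hom A B), cmp (idm B) f = f;
  cmpm1 : forall A B (f : Hom A B), cmp f (idm A) = f;
  cmpA : forall A B C D (h : Hom C D) (g : Hom B C) (f : Hom A B),
    cmp h (cmp g f) = cmp (cmp h g) f
}.
Arguments Hom {c} A B.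
Arguments idm {c} A.
Arguments cmp {c A B C} g f.

Definition opcat (C : category) : category :=
  @Category C (fun A B => @Hom C B A) (fun A => idm A)
    (fun A B D g f => cmp f g)
    (fun A B f => cmpm1 f) (fun A B f => cmp1m f)
    (fun A B D E h g f => esym (cmpA f g h)).

Definition is_iso (C : category) (A B : C) (f : Hom A B) : Prop :=
  exists g : Hom B A, cmp g f = idm A /\ cmp f g = idm B.

(* The functors with a prescribed action on objects. *)
Record functor_on (C D : category) (F0 : C -> D) := FunctorOn {
  fmor : forall A B, Hom A B -> Hom (F0 A) (F0 B);
  fmor1 : forall A, fmor (idm A) = idm (F0 A);
  fmorM : forall A B E (g : Hom B E) (f : Hom A B),
    fmor (cmp g f) = cmp (fmor g) (fmor f)
}.
Arguments fmor {C D F0} F {A B} f : rename.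

Record functor (C D : category) := Functor {
  fobj :> C -> D;
  fon :> functor_on fobj
}.

Definition idF (C : category) : functor C C :=
  Functor (@FunctorOn C C id (fun A B f => f)
    (fun _ => erefl) (fun _ _ _ _ _ => erefl)).

Lemma cmpF_id (C D E : category) (G : functor D E) (F : functor C D) (A : C) :
  fmor G (fmor F (idm A)) = idm (G (F A)).
Proof. by rewrite !fmor1. Qed.

Lemma cmpF_cmp (C D E : category) (G : functor D E) (F : functor C D)
    (A B K : C) (g : Hom B K) (f : Hom A B) :
  fmor G (fmor F (cmp g f)) = cmp (fmor G (fmor F g)) (fmor G (fmor F f)).
Proof. by rewrite !fmorM. Qed.

Definition cmpF (C D E : category) (G : functor D E) (F : functor C D) :
    functor C E :=
  Functor (@FunctorOn C E (fun A => G (F A)) (fun A B f => fmor G (fmor F f))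
    (cmpF_id G F) (@cmpF_cmp C D E G F)).

Definition nat_isomorphic (C D : category) (F G : functor C D) : Prop :=
  exists eta : forall A, Hom (F A) (G A),
    (forall A, is_iso (eta A)) /\
    (forall A B (f : Hom A B),
      cmp (eta B) (fmor F f) = cmp (fmor G f) (eta A)).

Definition is_equivalence (C D : category) (F : functor C D) : Prop :=
  exists G : functor D C,
    nat_isomorphic (cmpF G F) (idF C) /\ nat_isomorphic (cmpF F G) (idF D).

(** * Subcategories and extended images *)

Record subcategory (V : category) := Subcategory {
  sub_obj : V -> Prop;
  sub_hom : forall A B : V, Hom A B -> Prop;
  sub_ends : forall A B (f : Hom A B), sub_hom f -> sub_obj A /\ sub_obj B;
  sub_id : forall A, sub_obj A -> sub_hom (idm A);
  sub_cmp : forall A B C (g : Hom B C) (f : Hom A B),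
    sub_hom g -> sub_hom f -> sub_hom (cmp g f)
}.
Arguments sub_hom {V} S {A B} f : rename.

Lemma sig_Prop_eq (T : Type) (Q : T -> Prop) (x y : {t | Q t}) :
  sval x = sval y -> x = y.
Proof.
case: x y => [x Qx] [y Qy] /= xy; case: _ / xy Qy => Qy.
by rewrite (Prop_irrelevance Qx Qy).
Qed.

Section subcategory_category.
Context {V : category} (S : subcategory V).

Definition scobj : Type := {A : V | sub_obj S A}.
Definition schom (A B : scobj) : Type :=
  {f : Hom (sval A) (sval B) | sub_hom S f}.
Definition scid (A : scobj) : schom A A := exist _ _ (sub_id (svalP A)).
Definition sccmp (A B C : scobj) (g : schom B C) (f : schom A B) : schom A C :=
  exist _ _ (sub_cmp (svalP g) (svalP f)).

Lemma sccmp1m (A B : scobj) (f : schom A B) : sccmp (scid B) f = f.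
Proof. by apply: sig_Prop_eq; rewrite /= cmp1m. Qed.

Lemma sccmpm1 (A B : scobj) (f : schom A B) : sccmp f (scid A) = f.
Proof. by apply: sig_Prop_eq; rewrite /= cmpm1. Qed.

Lemma sccmpA (A B C D : scobj) (h : schom C D) (g : schom B C)
  (f : schom A B) : sccmp h (sccmp g f) = sccmp (sccmp h g) f.
Proof. by apply: sig_Prop_eq; rewrite /= cmpA. Qed.

Definition subcat_category : category :=
  Category sccmp1m sccmpm1 sccmpA.

End subcategory_category.

(* An isomorphism of V with source in S belongs to S, hence so do its target
   and its inverse. *)
Definition iso_closed (V : category) (S : subcategory V) : Prop :=
  forall (A B : V) (f : Hom A B), sub_obj S A -> is_iso f -> sub_hom S f.

Definition sub_contained (V : category) (S T : subcategory V) : Prop :=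
  (forall A, sub_obj S A -> sub_obj T A) /\
  (forall (A B : V) (f : Hom A B), sub_hom S f -> sub_hom T f).

Definition factors_through (U V : category) (F : functor U V)
    (S : subcategory V) : Prop :=
  (forall A, sub_obj S (F A)) /\
  (forall (A B : U) (f : Hom A B), sub_hom S (fmor F f)).

Definition is_extended_image (U V : category) (F : functor U V)
    (S : subcategory V) : Prop :=
  [/\ iso_closed S, factors_through F S &
      forall T : subcategory V,
        iso_closed T -> factors_through F T -> sub_contained S T].

Section corestriction.
Context {U V : category} {F : functor U V} {S : subcategory V}.
Context (FS : factors_through F S).

Definition cores_obj (A : U) : subcat_category S := exist _ (F A) (FS.1 A).
Definition cores_map (A B : U) (f : Hom A B) :
  Hom (cores_obj A) (cores_obj B) := exist _ (fmor F f) (FS.2 A B f).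

Lemma cores_map1 (A : U) : cores_map (idm A) = idm (cores_obj A).
Proof. by apply: sig_Prop_eq; rewrite /= fmor1. Qed.

Lemma cores_mapM (A B C : U) (g : Hom B C) (f : Hom A B) :
  cores_map (cmp g f) = cmp (cores_map g) (cores_map f).
Proof. by apply: sig_Prop_eq; rewrite /= fmorM. Qed.

Definition corestriction : functor U (subcat_category S) :=
  Functor (FunctorOn cores_map1 cores_mapM).

End corestriction.

(** * Disjunctively distributive lattices *)

Section finite_families.
Context {d : Order.disp_t} {L : tbMeetSemilatticeType d}.

Definition pairwise_disjoint (n : nat) (b : 'I_n -> L) : Prop :=
  forall i j, i != j -> (b i `&` b j = \bot)%O.

Definition is_join (n : nat) (b : 'I_n -> L) (j : L) : Prop :=
  supremums (range b) j.

Definition is_latfilter (F : set L) : Prop :=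
  [/\ F \top%O,
      forall x y, F x -> F y -> F (x `&` y)%O &
      forall x y, (x <= y)%O -> F x -> F y].

Definition is_dfilter (F : set L) : Prop :=
  is_latfilter F /\
  forall (n : nat) (b : 'I_n -> L) (j : L),
    pairwise_disjoint b -> is_join b j -> F j -> exists i, F (b i).

End finite_families.

(* The family indexed by 'I_0 is disjoint and its join is the least element,
   so that nothing is lost by starting from semilattices with a bottom. *)
Record djlat := DJLat {
  dj_disp : Order.disp_t;
  dj_sort :> tbMeetSemilatticeType dj_disp;
  dj_join : forall (n : nat) (b : 'I_n -> dj_sort),
    pairwise_disjoint b -> exists j, is_join b j;
  dj_distr : forall (n : nat) (b : 'I_n -> dj_sort) (j a : dj_sort),
    pairwise_disjoint b -> is_join b j ->
    is_join (fun i => a `&` b i)%O (a `&` j)%O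
}.

Definition disjunctive_hom (d d' : Order.disp_t) (L : tbMeetSemilatticeType d)
    (M : tbMeetSemilatticeType d') (f : L -> M) : Prop :=
  [/\ f \top%O = \top%O,
      forall x y, f (x `&` y)%O = (f x `&` f y)%O &
      forall (n : nat) (b : 'I_n -> L) (j : L),
        pairwise_disjoint b -> is_join b j -> is_join (f \o b) (f j)].

Record djhom (D E : djlat) := DJHom {
  djhom_fun :> D -> E;
  djhomP : disjunctive_hom djhom_fun
}.

Lemma djhom_eq (D E : djlat) (f g : djhom D E) : f =1 g -> f = g.
Proof.
case: f g => [f fP] [g gP] /= /funext fg.
by case: _ / fg gP => gP; rewrite (Prop_irrelevance fP gP).
Qed.

Lemma disjunctive_hom_bot (D E : djlat) (f : djhom D E) : f \bot%O = \bot%O.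
Proof.
have [_ _ fj] := djhomP f.
have nb (M : djlat) (b : 'I_0 -> M) : is_join b \bot%O.
  by split=> [y [i _ _]|x _]; [case: (notF (ltn_ord i))|exact: le0x].
have b0 : pairwise_disjoint (fun _ : 'I_0 => \bot%O : D) by case.
have [_ /(_ \bot%O) fle] := fj 0 _ _ b0 (nb _ _).
by apply/eqP; rewrite -lex0; apply: fle => y [i _ _]; case: (notF (ltn_ord i)).
Qed.

Lemma djhom_id_subproof (D : djlat) : disjunctive_hom (@id D).
Proof. by split. Qed.

Lemma djhom_cmp_subproof (D E K : djlat) (g : djhom E K) (f : djhom D E) :
  disjunctive_hom (g \o f).
Proof.
have [g1 gI gj] := djhomP g; have [f1 fI fj] := djhomP f.
split=> [|x y|n b j bd bj] /=; first by rewrite f1.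
  by rewrite fI gI.
apply: (gj n (f \o b)); last exact: fj.
by move=> i k ik /=; rewrite -fI bd// disjunctive_hom_bot.
Qed.

Definition djid (D : djlat) : djhom D D := DJHom (djhom_id_subproof D).
Definition djcmp (D E K : djlat) (g : djhom E K) (f : djhom D E) : djhom D K :=
  DJHom (djhom_cmp_subproof g f).

Lemma djcmp1m (D E : djlat) (f : djhom D E) : djcmp (djid E) f = f.
Proof. exact: djhom_eq. Qed.

Lemma djcmpm1 (D E : djlat) (f : djhom D E) : djcmp f (djid D) = f.
Proof. exact: djhom_eq. Qed.

Lemma djcmpA (D E K M : djlat) (h : djhom K M) (g : djhom E K)
  (f : djhom D E) : djcmp h (djcmp g f) = djcmp (djcmp h g) f.
Proof. exact: djhom_eq. Qed.

Definition DJLatCat : category := Category djcmp1m djcmpm1 djcmpA.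

(** * Preordered topological spaces *)

Record ptop := PTop {
  pt_sort :> topologicalType;
  pt_le : pt_sort -> pt_sort -> Prop;
  pt_le_refl : forall x, pt_le x x;
  pt_le_trans : forall x y z, pt_le x y -> pt_le y z -> pt_le x z
}.

Record ptmap (X Y : ptop) := PTMap {
  ptmap_fun :> X -> Y;
  ptmap_cont : continuous ptmap_fun;
  ptmap_mono : forall x y, pt_le x y -> pt_le (ptmap_fun x) (ptmap_fun y)
}.

Lemma ptmap_eq (X Y : ptop) (f g : ptmap X Y) : f =1 g -> f = g.
Proof.
case: f g => [f fc fm] [g gc gm] /= /funext fg.
case: _ / fg gc gm => gc gm.
by rewrite (Prop_irrelevance fc gc) (Prop_irrelevance fm gm).
Qed.

Lemma ptid_cont (X : ptop) : continuous (@id X).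
Proof. by move=> x. Qed.

Lemma ptcmp_cont (X Y Z : ptop) (g : ptmap Y Z) (f : ptmap X Y) :
  continuous (g \o f).
Proof.
move=> x; apply: continuous_comp; [exact: ptmap_cont|exact: ptmap_cont].
Qed.

Definition ptid (X : ptop) : ptmap X X :=
  PTMap (@ptid_cont X) (fun _ _ => id).
Definition ptcmp (X Y Z : ptop) (g : ptmap Y Z) (f : ptmap X Y) : ptmap X Z :=
  PTMap (@ptcmp_cont X Y Z g f)
    (fun x y xy => ptmap_mono g (ptmap_mono f xy)).

Lemma ptcmp1m (X Y : ptop) (f : ptmap X Y) : ptcmp (ptid Y) f = f.
Proof. exact: ptmap_eq. Qed.

Lemma ptcmpm1 (X Y : ptop) (f : ptmap X Y) : ptcmp f (ptid X) = f.
Proof. exact: ptmap_eq. Qed.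

Lemma ptcmpA (X Y Z W : ptop) (h : ptmap Z W) (g : ptmap Y Z)
  (f : ptmap X Y) : ptcmp h (ptcmp g f) = ptcmp (ptcmp h g) f.
Proof. exact: ptmap_eq. Qed.

Definition PTopCat : category := Category ptcmp1m ptcmpm1 ptcmpA.

Definition clopen_upper (X : ptop) (U : set X) : Prop :=
  clopen U /\ forall x y, pt_le x y -> U x -> U y.

Definition priestley (X : ptop) : Prop :=
  [/\ compact [set: X],
      forall x y : X, pt_le x y -> pt_le y x -> x = y &
      forall x y : X, ~ pt_le x y ->
        exists U : set X, [/\ clopen_upper U, U x & ~ U y]].

Definition clopen_upper_refinable (X : ptop) (U : set X) : Prop :=
  forall C : set (set X),
    (forall V, C V -> clopen_upper V) -> \bigcup_(V in C) V = U ->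
    exists R : set (set X),
      [/\ forall W, R W -> clopen_upper W,
          trivIset R id,
          \bigcup_(W in R) W = U &
          forall W, R W -> exists2 V, C V & W `<=` V].

(** * The space of disjunctive filters *)

Record dfilter (D : djlat) := DFilter {
  dfilter_set :> set D;
  dfilterP : is_dfilter dfilter_set
}.

(* Sets over a type form a Boolean algebra in the library (with inclusion as
   order), so [disjunctive_hom (@dfilters_at D)] says that finite meets become
   intersections, and disjoint joins become disjoint unions. *)
Definition dfilters_at (D : djlat) (x : D) : set (dfilter D) :=
  [set F : dfilter D | dfilter_set F x].

HB.instance Definition _ (D : djlat) := gen_eqMixin (dfilter D).
HB.instance Definition _ (D : djlat) := gen_choiceMixin (dfilter D).
HB.instance Definition _ (D : djlat) :=
  @isSubBaseTopological.Build (dfilter D) (set (dfilter D))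
    (range (@dfilters_at D) `|` [set ~` dfilters_at x | x in [set: D]]) id.

Definition Pspace (D : djlat) : ptop :=
  @PTop (dfilter D) (fun F G => (F : set D) `<=` (G : set D))
    (fun F => @subset_refl D F) (fun F G H => @subset_trans D G F H).

(** * Free Boolean algebras *)

Definition is_prime_filter (d : Order.disp_t) (B : ctbDistrLatticeType d)
    (G : set B) : Prop :=
  [/\ is_latfilter G, ~ G \bot%O &
      forall x y, G (x `|` y)%O -> G x \/ G y].

(* Not [{tblmorphism B -> B'}], which only requires the preservation of bottom
   and top. Preservation of complements follows. *)
Definition is_boolean_hom (d d' : Order.disp_t) (B : ctbDistrLatticeType d)
    (B' : ctbDistrLatticeType d') (g : B -> B') : Prop :=
  [/\ g \bot%O = \bot%O, g \top%O = \top%O,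
      forall x y, g (x `&` y)%O = (g x `&` g y)%O &
      forall x y, g (x `|` y)%O = (g x `|` g y)%O].

Definition is_free_boolean (D : djlat) (d : Order.disp_t)
    (B : ctbDistrLatticeType d) (u : D -> B) : Prop :=
  disjunctive_hom u /\
  forall (d' : Order.disp_t) (B' : ctbDistrLatticeType d') (h : D -> B'),
    disjunctive_hom h ->
    exists! g : B -> B', is_boolean_hom g /\ forall x, g (u x) = h x.

Section upper_elements.
Context {D : djlat} {d : Order.disp_t} {B : ctbDistrLatticeType d}.
Context (u : D -> B).

(* This is the order of [Pspace D] transported along restriction, not the
   inclusion of prime filters of B, which is trivial. *)
Definition upper_element (b : B) : Prop :=
  forall G G' : set B, is_prime_filter G -> is_prime_filter G' ->
    u @^-1` G `<=` u @^-1` G' -> G b -> G' b.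

Definition upper_refinable (b : B) : Prop :=
  forall (n : nat) (c : 'I_n -> B),
    (forall i, upper_element (c i)) -> (\join_(i < n) c i)%O = b ->
    exists (m : nat) (r : 'I_m -> B),
      [/\ forall k, upper_element (r k),
          pairwise_disjoint r,
          (\join_(k < m) r k)%O = b &
          forall k, exists i, (r k <= c i)%O].

End upper_elements.

(* Main.v *)
Require Import Defs.
From HB Require Import structures.
From mathcomp Require Import all_boot all_order.
From mathcomp Require Import finmap.
From mathcomp Require Import all_classical.
From mathcomp Require Import topology.

(** Write [d] for the set of disjunctive filters containing d. The algebra and
    the topology meet in one separation principle, [disjunctive_ideal_avoid]:
    an element outside a disjunctive ideal (a lower set closed under finite
    disjoint joins) belongs to a disjunctive filter disjoint from that ideal,
    namely to any filter that is maximal among those containing the element and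
    disjoint from the ideal.
    For the ideal of the elements below y this gives that d |-> [d] is an order
    embedding. For the ideal generated by a set V it gives
    [disjoint_refinement]: if the sets [a], for a in V, cover [x], then x is a
    finite disjoint join of elements lying below elements of V.

    Limits of ultrafilters are disjunctive filters, so the space is compact, and
    the [d] included in a clopen upper set U cover U. The sets [d] are then
    exactly the refinable clopen upper sets. Every [d] is refinable by
    [disjoint_refinement]. If conversely U is refinable, refine its covering by the [d] included in it: each piece W lies in some
    [d], and W and [d] minus W are both clopen upper sets, the latter because it
    is cut out in [d] by the other pieces. Refining the covering of [d] by these
    two sets shows that W is some [e] ([dfilters_at_summand]), and finitely many
    of these disjoint sets [e] cover U by compactness, so that U is the set [j]
    of their join j.

    Since the lattice is thus described by means of the ordered space alone,
    every isomorphism between spaces P(D) comes from a lattice homomorphism.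
    P is moreover faithful, and for a faithful functor that is full on
    isomorphisms the arrows that are isomorphic to arrows in the image form
    a subcategory; it is the extended image, and the functor is an equivalence
    onto it.

    The Boolean algebra of subsets of the space generated by the [d] is free on
    D. Given a disjunctive homomorphism h from D to a Boolean algebra B, inverse
    image along h sends prime filters of B to disjunctive filters, and every
    generated set U is represented by an element b of B, whose prime filters are
    those with inverse image in U; b is unique by the prime filter theorem,
    which is the separation principle applied to B. For an arbitrary free
    algebra, freeness with respect to the two-element algebra identifies prime
    filters with disjunctive filters, and its comparison with the generated
    algebra shows that its elements represent clopen sets; upper elements
    represent clopen upper sets, and the argument for refinable clopen upper
    sets applies to refinable upper elements. *)

Set Implicit Arguments.
Unset Strict Implicit.
Unset Printing Implicit Defensive.

Import Order.Theory.
Local Open Scope classical_set_scope.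
Local Open Scope order_scope.

(** * Disjoint joins and separation by disjunctive filters *)

Section joins.
Context {d : Order.disp_t} {L : tbMeetSemilatticeType d}.
Implicit Types (x y z : L).

Lemma is_joinP (n : nat) (b : 'I_n -> L) (j : L) :
  is_join b j <->
  (forall i, b i <= j) /\ (forall z, (forall i, b i <= z) -> j <= z).
Proof.
split=> [[jub jleast]|[jub jleast]].
  split=> [i|z bz]; first by apply: jub; exists i.
  by apply: jleast => _ [i _ <-].
split=> [_ [i _ <-]|z bz]; first exact: jub.
by apply: jleast => i; apply: bz; exists i.
Qed.

Lemma is_join_unique (n : nat) (b : 'I_n -> L) (j k : L) :
  is_join b j -> is_join b k -> j = k.
Proof. exact: is_subset1_supremums. Qed.

Lemma disjoint_le x y x' y' :
  x <= x' -> y <= y' -> x' `&` y' = \bot -> x `&` y = \bot.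
Proof.
by move=> xx' yy' xy0; apply/eqP; rewrite -lex0 -xy0 leI2.
Qed.

Lemma pairwise_disjoint_le (n : nat) (b c : 'I_n -> L) :
  (forall i, b i <= c i) -> pairwise_disjoint c -> pairwise_disjoint b.
Proof.
by move=> bc cd i k ik; apply: disjoint_le (bc i) (bc k) (cd i k ik).
Qed.

Lemma latfilter_up (x : L) : is_latfilter [set z | x <= z].
Proof.
split=> [|y z xy xz|y z yz xy] /=; first exact: lex1.
  by rewrite lexI xy.
exact: le_trans xy yz.
Qed.

Lemma latfilter_meets (F : set L) (T : eqType) (s : seq T) (f : T -> L) :
  is_latfilter F -> (forall i, i \in s -> F (f i)) -> F (\meet_(i <- s) f i).
Proof.
move=> [F1 FI _] Ff; rewrite big_seq.
by elim/big_ind: _ => //; exact: FI.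
Qed.

End joins.

Lemma is_join_set (T : Type) (n : nat) (b : 'I_n -> set T) (U : set T) :
  is_join b U <-> \bigcup_i b i = U.
Proof.
split=> [/is_joinP[bU Uleast]|<-].
  rewrite eqEsubset; split=> [t [i _]|]; first exact/subsetPset.
  by apply/subsetPset/Uleast => i; apply/subsetPset => t bt; exists i.
apply/is_joinP; split=> [i|V bV]; first by apply/subsetPset => t bt; exists i.
by apply/subsetPset => t [i _]; move/subsetPset: (bV i); apply.
Qed.

Section disjunctive_ideals.
Context {D : djlat}.
Implicit Types (x y z : D) (V I : set D).

(** Joins of disjoint families are axiomatized for families indexed by ordinals;
    double families and finite sets of elements are reindexed by enumeration. *)
Lemma disjoint_join_fintype (T : finType) (b : T -> D) :
  (forall i k, i != k -> b i `&` b k = \bot) ->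
  exists (n : nat) (c : 'I_n -> D) (j : D),
    [/\ pairwise_disjoint c, is_join c j, forall i, exists k, c i = b k &
        (forall k, b k <= j)].
Proof.
move=> bd; pose c (i : 'I_#|T|) := b (enum_val i).
have cd : pairwise_disjoint c.
  by move=> i k ik; apply: bd; apply: contraNneq ik => /enum_val_inj ->.
have [j cj] := dj_join cd.
exists #|T|, c, j; split=> // [i|k]; first by exists (enum_val i).
by have [cub _] := (is_joinP _ _).1 cj; rewrite -(enum_rankK k) cub.
Qed.

(** The least element belongs to such a set, as the join of the empty family. *)
Definition disjunctive_ideal I : Prop :=
  (forall x y, x <= y -> I y -> I x) /\
  (forall (n : nat) (b : 'I_n -> D) (j : D),
    pairwise_disjoint b -> is_join b j -> (forall i, I (b i)) -> I j).

Lemma disjunctive_ideal_down y : disjunctive_ideal [set x | x <= y].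
Proof.
split=> [x z /le_trans xz|n b j _ /is_joinP[_ jleast]]; first exact: xz.
exact: jleast.
Qed.

(** Let F be maximal among the filters containing x and disjoint from I, and let
    j in F be a disjoint join of elements b i outside F. By maximality some f i
    in F has f i /\ b i in I; then with f the meet of the f i, the element
    f /\ j of F is the disjoint join of the elements f /\ b i of I, so it
    belongs to I, a contradiction. *)
Lemma disjunctive_ideal_avoid I x :
  disjunctive_ideal I -> ~ I x ->
  exists2 F : dfilter D, dfilters_at x F & forall y, I y -> ~ dfilters_at y F.
Proof.
move=> [Idown Ijoin] Ix.
pose good (F : set D) := [/\ is_latfilter F, F x & forall y, I y -> ~ F y].
(* The empty set is let in so that the union of the empty chain qualifies. *)
have [C Ctot|A [Agood Amax]] := @Zorn_bigcup D [set F | F !=set0 -> good F].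
  move=> tot [y [X CX Xy]].
  have goodC Y z : C Y -> Y z -> good Y.
    by move=> CY Yz; apply: (Ctot Y CY); exists z.
  have [[X1 XI Xup] Xx XnI] := goodC _ _ CX Xy.
  split; last 2 first.
  - by exists X.
  - by move=> z Iz [Z CZ Zz]; have [_ _ ZnI] := goodC _ _ CZ Zz; exact: ZnI Zz.
  split=> [|y1 y2 [Y1 CY1 Yy1] [Y2 CY2 Yy2]|y1 y2 y12 [Y CY Yy1]].
  - by exists X.
  - have [Y12|Y21] := tot _ _ CY1 CY2.
    + exists Y2 => //; have [[_ YI _] _ _] := goodC _ _ CY2 Yy2.
      by apply: YI => //; exact: Y12.
    + exists Y1 => //; have [[_ YI _] _ _] := goodC _ _ CY1 Yy1.
      by apply: YI => //; exact: Y21.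
  - by exists Y => //; have [[_ _ Yup] _ _] := goodC _ _ CY Yy1; exact: Yup Yy1.
have upgood : good [set z | x <= z].
  split; [exact: latfilter_up|exact: lexx|].
  by move=> y Iy /= xy; apply: Ix; exact: Idown Iy.
have {Agood} [Afil Ax AnI] : good A.
  apply: Agood; apply: contrapT => A0; apply: (Amax [set z | x <= z]) => //.
  split=> [y Ay|/(_ x (lexx x)) Ax]; last by apply: A0; exists x.
  by exfalso; apply: A0; exists y.
have [A1 AI Aup] := Afil.
(* By maximality, the filter generated by A and an element outside A meets I. *)
have outside y : ~ A y -> exists2 f, A f & I (f `&` y).
  move=> nAy; apply: contrapT => nI.
  apply: (Amax [set z | exists2 f, A f & f `&` y <= z]).
    split=> [z Az|sub]; first by exists z => //; exact: leIl.
    by apply: nAy; apply: sub; exists \top => //; exact: leIr.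
  move=> _; split; last 2 first.
  - by exists x => //; exact: leIl.
  - by move=> z Iz [f Af fz]; apply: nI; exists f => //; exact: Idown fz Iz.
  split=> [|z1 z2 [f1 Af1 fz1] [f2 Af2 fz2]|z1 z2 z12 [f Af fz]].
  - by exists \top => //; exact: lex1.
  - exists (f1 `&` f2); first exact: AI.
    rewrite lexI (le_trans _ fz1) ?(le_trans _ fz2)//.
      by rewrite leI2// leIr.
    by rewrite leI2// leIl.
  - by exists f => //; exact: le_trans fz z12.
suff Adf : is_dfilter A by exists (DFilter Adf).
split=> // n b j bd bj Aj; apply: contrapT => nAb.
have /choice[f /all_and2 [Af Ifb]] i : exists f, A f /\ I (f `&` b i).
  have [Abi|f Af If] := outside (b i); first by apply: nAb; exists i.
  by exists f.
pose g := \meet_(i < n) f i.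
apply: (AnI (g `&` j)); last by apply: AI => //; exact: latfilter_meets.
apply: Ijoin (dj_distr g bd bj) _ => [|i].
  by apply: pairwise_disjoint_le bd => i; exact: leIr.
by apply: Idown (Ifb i); rewrite leI2// meets_inf.
Qed.

Lemma sub_dfilters_at x y : dfilters_at x `<=` dfilters_at y <-> x <= y.
Proof.
split=> [xy|xy F Fx].
  apply: contrapT => nxy.
  have [F Fx /(_ y (lexx y))] :=
    disjunctive_ideal_avoid (disjunctive_ideal_down y) nxy.
  by apply; exact: xy.
by have [[_ _ Fup] _] := dfilterP F; exact: Fup Fx.
Qed.

Lemma dfilters_at_le x y F :
  x <= y -> dfilters_at x F -> dfilters_at y F.
Proof. by move/sub_dfilters_at; apply. Qed.

Lemma dfilters_at_inj : injective (@dfilters_at D).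
Proof.
by move=> x y xy; apply/eqP; rewrite eq_le; apply/andP; split;
  apply/sub_dfilters_at; rewrite xy.
Qed.

(** The disjunctive ideal generated by V. *)
Definition disjointly_covered V x : Prop :=
  exists (n : nat) (b : 'I_n -> D),
    [/\ pairwise_disjoint b, is_join b x &
        forall i, exists2 a, V a & b i <= a].

(** Coverings restrict along meets by distributivity, and substituting coverings
    of the members of a disjoint family gives a disjoint double family. *)
Lemma disjunctive_ideal_covered V : disjunctive_ideal (disjointly_covered V).
Proof.
split=> [x y xy [n [b [bd bj bV]]]|n c j cd cj cV].
  exists n, (fun i => x `&` b i); split=> [| |i].
  - by apply: pairwise_disjoint_le bd => i; exact: leIr.
  - by have := dj_distr x bd bj; rewrite (meet_l xy).
  - by have [a Va ba] := bV i; exists a => //; apply: le_trans ba; exact: leIr.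
pose m k := sval (cid (cV k)).
pose b k : 'I_(m k) -> D := sval (cid (svalP (cid (cV k)))).
have /all_and3[bd bj bV] k := svalP (cid (svalP (cid (cV k)))).
pose T := {k : 'I_n & 'I_(m k)}; pose B (t : T) := b (tag t) (tagged t).
have Bc t : B t <= c (tag t).
  by have [+ _] := (is_joinP _ _).1 (bj (tag t)); apply.
have Bd t u : t != u -> B t `&` B u = \bot.
  case: t u => [k i] [k' i']; have [kk'|kk'] := eqVneq k k'; last first.
    by move=> _; apply: disjoint_le (Bc _) (Bc _) _; exact: cd.
  case: _ / kk' i' => i' ii'; apply: bd; apply: contraNneq ii'.
  by rewrite /= => ->.
have [p [C [J [Cd CJ CB BJ]]]] := disjoint_join_fintype Bd.
exists p, C; split=> // [|i]; last first.
  by have [t ->] := CB i; have [a Va ba] := bV (tag t) (tagged t); exists a.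
suff -> : j = J by [].
have [cub cleast] := (is_joinP _ _).1 cj.
have [Cub Cleast] := (is_joinP _ _).1 CJ.
apply/eqP; rewrite eq_le; apply/andP; split.
  apply: cleast => k; have [_] := (is_joinP _ _).1 (bj k); apply => i.
  exact: (BJ (Tagged (fun k => 'I_(m k)) i)).
apply: Cleast => i; have [t ->] := CB i.
exact: le_trans (Bc t) (cub _).
Qed.

(** V may be infinite: the ideal generated by V consists of finite joins, so
    this statement contains the compactness of the set of filters at x. *)
Lemma disjoint_refinement V x :
  (forall F, dfilters_at x F -> exists2 a, V a & dfilters_at a F) ->
  disjointly_covered V x.
Proof.
move=> Vx; apply: contrapT => nx.
have [F Fx Fn] := disjunctive_ideal_avoid (disjunctive_ideal_covered V) nx.
have [a Va Fa] := Vx F Fx; apply: Fn Fa.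
exists 1%N, (fun=> a); split=> [i k|/=|_]; last by exists a.
  by rewrite !ord1 eqxx.
by apply/is_joinP; split=> // z; apply; exact: ord0.
Qed.

End disjunctive_ideals.

Local Open Scope classical_set_scope.

(** * The Priestley space of disjunctive filters *)

Section dfilter_sets.
Context {D : djlat}.
Implicit Types (x y : D) (F G : dfilter D).

Lemma dfilter_eq F G : dfilter_set F = dfilter_set G -> F = G.
Proof.
case: F G => [F Fd] [G Gd] /= FG; case: _ / FG Gd => Gd.
by rewrite (Prop_irrelevance Fd Gd).
Qed.

Lemma dfilters_atT : dfilters_at (\top%O : D) = setT.
Proof. by rewrite -subTset => F _; have [[]] := dfilterP F. Qed.

Lemma dfilters_atI x y :
  dfilters_at (x `&` y)%O = dfilters_at x `&` dfilters_at y.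
Proof.
rewrite eqEsubset; split=> [F Fxy|F [Fx Fy]].
  by split; [apply: dfilters_at_le Fxy; exact: leIl
            |apply: dfilters_at_le Fxy; exact: leIr].
by have [[_ FI _] _] := dfilterP F; exact: FI.
Qed.

Lemma dfilters_at_join (n : nat) (b : 'I_n -> D) (j : D) :
  pairwise_disjoint b -> is_join b j ->
  dfilters_at j = \bigcup_i dfilters_at (b i).
Proof.
move=> bd bj; rewrite eqEsubset; split=> [F Fj|F [i _]].
  by have [_ Fdj] := dfilterP F; have [i Fbi] := Fdj n b j bd bj Fj; exists i.
by apply: dfilters_at_le; have [+ _] := (is_joinP _ _).1 bj; apply.
Qed.

Lemma dfilters_at0 : dfilters_at (\bot%O : D) = set0.
Proof.
have b0 : @pairwise_disjoint _ D 0 (fun=> \bot%O) by case.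
rewrite (dfilters_at_join b0 (j := \bot%O)); last first.
  by apply/is_joinP; split=> [[]|z _] //; exact: le0x.
by rewrite -subset0 => F [[]].
Qed.

Lemma disjunctive_dfilters_at : disjunctive_hom (@dfilters_at D).
Proof.
split; [exact: dfilters_atT|exact: dfilters_atI|move=> n b j bd bj].
by apply/is_join_set; rewrite (dfilters_at_join bd bj).
Qed.

Lemma disjoint_dfilters_at x y :
  dfilters_at x `&` dfilters_at y = set0 <-> (x `&` y = \bot)%O.
Proof.
rewrite -dfilters_atI -dfilters_at0.
by split=> [/dfilters_at_inj|->].
Qed.

Lemma open_subbasic (U : set (dfilter D)) :
  (range (@dfilters_at D) `|` [set ~` dfilters_at x | x in [set: D]]) U ->
  open U.
Proof.
move=> DU; exists [set U]; last by rewrite bigcup_set1.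
move=> _ ->; exists [fset U]%fset.
  by move=> V /fset1P ->; exact: mem_set.
by rewrite set_fset1 bigcap_set1.
Qed.

Lemma clopen_dfilters_at x : clopen (dfilters_at x).
Proof.
split; first by apply: open_subbasic; left; exists x.
by rewrite -openC; apply: open_subbasic; right; exists x.
Qed.

Lemma cvg_dfilter (Phi : set_system (dfilter D)) F : Filter Phi ->
  (forall x, dfilters_at x F -> Phi (dfilters_at x)) ->
  (forall x, ~ dfilters_at x F -> Phi (~` dfilters_at x)) ->
  Phi --> F.
Proof.
move=> Phifil Phiat PhiC A.
rewrite nbhsE => -[_ [[B sB <-] [C BC CF]] sUBA].
apply: filterS sUBA _; apply: (@filterS _ _ _ C).
  by move=> G CG; exists C.
have /sB [E sE IEC] := BC; rewrite -IEC.
apply: filter_bigI => V EV; rewrite -IEC in CF.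
have := sE V EV; rewrite inE => -[|] [x _ xV]; move: (CF V EV); rewrite -xV.
  exact: Phiat.
exact: PhiC.
Qed.

End dfilter_sets.

Lemma continuous_dfilter (X : topologicalType) (D : djlat)
    (f : X -> dfilter D) :
  (forall x, clopen (f @^-1` dfilters_at x)) -> continuous f.
Proof.
move=> fclopen t; apply: cvg_dfilter => x fx.
  by apply: open_nbhs_nbhs; split=> //; have [] := fclopen x.
apply: (@open_nbhs_nbhs _ t (~` (f @^-1` dfilters_at x))); split=> //.
by rewrite openC; have [] := fclopen x.
Qed.

Lemma ultra_bigcup (T : Type) (Phi : set_system T) (n : nat)
    (A : 'I_n -> set T) :
  UltraFilter Phi -> Phi (\bigcup_i A i) -> exists i, Phi (A i).
Proof.
move=> Phiu PhiA; apply: contrapT => nA; apply: (@filter_not_empty _ Phi).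
have PhiC : Phi [set t | forall i, (~` A i) t].
  apply: filter_forall => i.
  by have [PhiAi|//] := in_ultra_setVsetC (A i) Phiu; case: nA; exists i.
apply: filterS (filterI PhiA PhiC) => t [[i _ Ait] /(_ i)]; exact.
Qed.

(** A point of A makes X a pointed space; the empty set is covered by the empty
    subfamily. *)
Lemma compact_finite_subcover (X : topologicalType) (A : set X) :
  compact A -> cover_compact A.
Proof.
move=> Ac; have [A0|/set0P[p _]] := eqVneq A set0.
  by move=> I E f _ _; exists fset0; [|rewrite A0].
pose Xp := HB.pack_for ptopologicalType X (isPointed.Build X p).
have XpA : @compact Xp A by [].
by rewrite compact_cover in XpA.
Qed.

Section spectrum.
Context {D : djlat}.
Implicit Types (x y : D) (F G : dfilter D).

(** An ultrafilter Phi converges to the set of all x such that the filters at x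
    form a member of Phi: this is a disjunctive filter because an ultrafilter
    that contains a finite union contains one of its terms. *)
Lemma compact_Pspace : compact [set: Pspace D].
Proof.
rewrite compact_ultra => Phi Phiu _.
have Phidf : is_dfilter [set x : D | Phi (dfilters_at x)].
  split; first split=> [|x y Px Py|x y xy] /=.
  - by rewrite dfilters_atT; exact: filterT.
  - by rewrite dfilters_atI; exact: filterI.
  - by apply: filterS; exact/sub_dfilters_at.
  - by move=> n b j bd bj /=; rewrite (dfilters_at_join bd bj) => /ultra_bigcup.
exists (DFilter Phidf); split=> //; apply: cvg_dfilter => // x nPx.
by have [|//] := in_ultra_setVsetC (dfilters_at x) Phiu.
Qed.

Lemma clopen_upper_dfilters_at x : @clopen_upper (Pspace D) (dfilters_at x).
Proof. by split=> [|F G FG]; [exact: clopen_dfilters_at|exact: FG]. Qed.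

Lemma priestley_Pspace : priestley (Pspace D).
Proof.
split=> [|F G FG GF|F G]; first exact: compact_Pspace.
  by apply: dfilter_eq; rewrite eqEsubset.
move=> /existsNP[x /not_implyP[Fx nGx]].
by exists (dfilters_at x); split=> //; exact: clopen_upper_dfilters_at.
Qed.

(** For F in U and G outside U, upper closure of U gives an element of F that is
    not in G; by compactness of the complement of U finitely many elements of F
    suffice for all G, and x is their meet. *)
Lemma clopen_upper_basis (U : set (Pspace D)) F : clopen_upper U -> U F ->
  exists2 x, dfilters_at x F & dfilters_at x `<=` U.
Proof.
move=> [[Uo _] Uup] UF.
have : compact (~` U).
  by apply: subclosed_compact compact_Pspace _ => //; rewrite closedC.
move=> /compact_finite_subcover/(_ D (dfilter_set F)
  (fun x => ~` dfilters_at x)).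
case=> [x _|G nUG|E EF UE].
- by rewrite openC; have [] := clopen_dfilters_at x.
- apply: contrapT => nG; apply: nUG; apply: Uup UF => x Fx.
  by apply: contrapT => nGx; apply: nG; exists x.
exists (\meet_(x <- E) x)%O.
  apply: latfilter_meets; first by have [] := dfilterP F.
  by move=> x /EF; rewrite inE.
move=> G Gm; apply: contrapT => /UE[x /= Ex]; apply.
by apply: dfilters_at_le Gm; exact: meets_inf_seq.
Qed.

(** A finite disjoint refinement of the covering of x by U and its complement
    splits into the terms included in U, whose join defines U, and the
    others. *)
Lemma dfilters_at_summand (U : set (Pspace D)) x :
  clopen_upper U -> clopen_upper (dfilters_at x `\` U : set (Pspace D)) ->
  U `<=` dfilters_at x -> exists y, dfilters_at y = U.
Proof.
move=> Ucu UCcu Ux.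
have [F Fx|n [b [bd bj bV]]] := @disjoint_refinement _
    [set a : D | dfilters_at a `<=` U \/
      dfilters_at a `<=` dfilters_at x `\` U] x.
  have [UF|nUF] := pselect (U F).
    by have [a Fa aU] := clopen_upper_basis Ucu UF; exists a => //; left.
  have [a Fa aU] := clopen_upper_basis UCcu (conj Fx nUF).
  by exists a => //; right.
(* The other terms are replaced by the least element, to keep the indices. *)
pose c i := if `[< dfilters_at (b i) `<=` U >] then b i else \bot%O.
have cb i : (c i <= b i)%O by rewrite /c; case: ifP => // _; exact: le0x.
have cd : pairwise_disjoint c by exact: pairwise_disjoint_le bd.
have [y cy] := dj_join cd; exists y.
rewrite (dfilters_at_join cd cy) eqEsubset; split=> [F [i _]|F UF].
  by rewrite /c; case: asboolP => [bU|_]; [exact: bU|rewrite dfilters_at0].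
have := Ux F UF; rewrite (dfilters_at_join bd bj) => -[i _ bF].
exists i => //; rewrite /c; case: asboolP => // nbU.
have [a [aU|aU] ba] := bV i.
  by case: nbU; apply: subset_trans aU; exact/sub_dfilters_at.
by have /sub_dfilters_at/(_ F bF)/aU[] := ba.
Qed.

Lemma trivIset_range_dfilters_at (n : nat) (b : 'I_n -> D) :
  pairwise_disjoint b -> trivIset (range (fun i => dfilters_at (b i))) id.
Proof.
move=> bd _ _ [i _ <-] [k _ <-] /= [F [bi bk]]; congr dfilters_at.
have [->//|/bd/disjoint_dfilters_at ik0] := eqVneq i k.
by have : (dfilters_at (b i) `&` dfilters_at (b k)) F by []; rewrite ik0.
Qed.

Lemma clopen_upper_refinable_dfilters_at x :
  @clopen_upper_refinable (Pspace D) (dfilters_at x).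
Proof.
move=> C Ccu CU.
have [F|n [b [bd bj bV]]] := @disjoint_refinement _
    [set a : D | exists2 V, C V & dfilters_at a `<=` V] x.
  rewrite -CU => -[V CV VF].
  have [a Fa aV] := clopen_upper_basis (Ccu V CV) VF.
  by exists a => //; exists V.
exists (range (fun i => dfilters_at (b i))); split.
- by move=> _ [i _ <-]; exact: clopen_upper_dfilters_at.
- exact: trivIset_range_dfilters_at.
- by rewrite bigcup_image (dfilters_at_join bd bj).
- move=> _ [i _ <-]; have [a [V CV aV] ba] := bV i.
  by exists V => //; apply: subset_trans aV; exact/sub_dfilters_at.
Qed.

(** By compactness finitely many members of R cover U. *)
Lemma dfilters_at_disjoint_bigcup (U : set (Pspace D))
    (R : set (set (Pspace D))) :
  clopen U -> trivIset R id -> \bigcup_(W in R) W = U ->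
  (forall W, R W -> exists y, dfilters_at y = W) ->
  exists x, dfilters_at x = U.
Proof.
move=> [Uo Uc] Rd RU Rat.
have : compact U by apply: subclosed_compact compact_Pspace _.
move=> /compact_finite_subcover/(_ (set (Pspace D)) R id).
case=> [W /Rat[y <-]||E ER UE].
- by have [] := clopen_dfilters_at y.
- by rewrite -RU.
pose T := fset_sub_type E.
have Tat (W : T) : exists y, dfilters_at y = val W.
  by apply: Rat; have := ER _ (valP W); rewrite inE.
have [b bE] := choice Tat.
have bd (V W : T) : V != W -> (b V `&` b W = \bot)%O.
  move=> VW; apply/disjoint_dfilters_at; rewrite !bE -subset0 => F [VF WF].
  have RT (Z : T) : R (val Z) by have := ER _ (valP Z); rewrite inE.
  move/eqP: VW; apply; apply: val_inj.
  by apply: (Rd _ _ (RT V) (RT W)); exists F.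
have [n [c [x [cd cx cb bx]]]] := disjoint_join_fintype bd.
exists x; rewrite eqEsubset; split=> [F|F /UE [W EW WF]].
  rewrite (dfilters_at_join cd cx) => -[i _]; have [k ->] := cb i.
  rewrite bE -RU => kF; exists (val k) => //.
  by have := ER _ (valP k); rewrite inE.
have : dfilters_at (b (FSetSub EW)) F by rewrite bE.
exact: dfilters_at_le.
Qed.

(** Inside the filters at x, the complement of W is the union of the other
    members of R, which are upper sets. *)
Lemma clopen_upper_setD_disjoint x (R : set (set (Pspace D)))
    (W : set (Pspace D)) :
  (forall V, R V -> clopen_upper V) -> trivIset R id -> R W ->
  dfilters_at x `<=` \bigcup_(V in R) V ->
  clopen_upper (dfilters_at x `\` W : set (Pspace D)).
Proof.
move=> Rcu Rd RW xR; split.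
  apply: clopenI; first exact: clopen_dfilters_at.
  by apply: clopenC; have [] := Rcu W RW.
move=> F G FG [Fx nWF]; split; first exact: FG.
move=> WG; apply: nWF; have [V RV VF] := xR F Fx.
have [_ /(_ F G FG VF) VG] := Rcu V RV.
by rewrite -(Rd V W RV RW) //; exists G.
Qed.

(** The covering of U to which refinability is applied consists of all the basic
    sets included in U, so that every piece of the refinement is a summand of
    a basic set. *)
Lemma range_dfilters_at : range (@dfilters_at D) =
  [set U : set (Pspace D) | clopen_upper U /\ clopen_upper_refinable U].
Proof.
rewrite eqEsubset; split=> [_ [x _ <-]|U [Ucu Uref]].
  split; [exact: clopen_upper_dfilters_at
         |exact: clopen_upper_refinable_dfilters_at].
have [||R [Rcu Rd RU Rat]] :=
    Uref [set V | exists2 x, dfilters_at x `<=` U & V = dfilters_at x].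
- by move=> _ [x _ ->]; exact: clopen_upper_dfilters_at.
- rewrite eqEsubset; split=> [F [_ [x xU ->]]|F UF]; first exact: xU.
  have [x xF xU] := clopen_upper_basis Ucu UF.
  by exists (dfilters_at x) => //; exists x.
suff [x <-] : exists x, dfilters_at x = U by exists x.
apply: (dfilters_at_disjoint_bigcup Ucu.1 Rd RU) => W RW.
have [_ [x xU ->] Wx] := Rat W RW.
apply: dfilters_at_summand Wx; first exact: Rcu.
by apply: clopen_upper_setD_disjoint RW _ => //; rewrite RU.
Qed.

End spectrum.

(** * Extended images of functors that are full on isomorphisms *)

Section isomorphisms.
Context {C : category}.
Implicit Types (X Y Z : C).

Lemma is_iso_idm X : is_iso (idm X).
Proof. by exists (idm X); rewrite cmp1m. Qed.

Lemma is_iso_cmp X Y Z (g : Hom Y Z) (f : Hom X Y) :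
  is_iso g -> is_iso f -> is_iso (cmp g f).
Proof.
move=> [g' [g'g gg']] [f' [f'f ff']]; exists (cmp f' g'); split.
  by rewrite -cmpA (cmpA g') g'g cmp1m.
by rewrite -cmpA (cmpA f) ff' cmp1m.
Qed.

End isomorphisms.

Definition faithful (C D : category) (F : functor C D) : Prop :=
  forall (A B : C) (f g : Hom A B), fmor F f = fmor F g -> f = g.

Definition full (C D : category) (F : functor C D) : Prop :=
  forall (A B : C) (h : Hom (F A) (F B)), exists f : Hom A B, fmor F f = h.

Definition full_on_isos (C D : category) (F : functor C D) : Prop :=
  forall (A B : C) (h : Hom (F A) (F B)), is_iso h ->
    exists f : Hom A B, fmor F f = h.

Definition essentially_surjective (C D : category) (F : functor C D) : Prop :=
  forall X : D, exists (A : C) (a : Hom (F A) X), is_iso a.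

Section equivalence.
Context {C D : category} (F : functor C D).
Hypotheses (Ffaithful : faithful F) (Ffull : full F).
Hypothesis Fsurj : essentially_surjective F.

Let G0 (X : D) : C := sval (cid (Fsurj X)).
Let e (X : D) : Hom (F (G0 X)) X := sval (cid (svalP (cid (Fsurj X)))).

Let eP (X : D) : is_iso (e X).
Proof. exact: svalP (cid (svalP (cid (Fsurj X)))). Qed.

Let ei (X : D) : Hom X (F (G0 X)) := sval (cid (eP X)).

Let eiK (X : D) : cmp (ei X) (e X) = idm (F (G0 X)).
Proof. by have [] := svalP (cid (eP X)). Qed.

Let eK (X : D) : cmp (e X) (ei X) = idm X.
Proof. by have [] := svalP (cid (eP X)). Qed.

Let G1 (X Y : D) (h : Hom X Y) : Hom (G0 X) (G0 Y) :=
  sval (cid (Ffull (cmp (ei Y) (cmp h (e X))))).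

Let FG1 (X Y : D) (h : Hom X Y) :
  fmor F (G1 h) = cmp (ei Y) (cmp h (e X)).
Proof. exact: svalP (cid (Ffull _)). Qed.

Let G1_idm (X : D) : G1 (idm X) = idm (G0 X).
Proof. by apply: Ffaithful; rewrite FG1 fmor1 cmp1m eiK. Qed.

Let G1_cmp (X Y Z : D) (h : Hom Y Z) (k : Hom X Y) :
  G1 (cmp h k) = cmp (G1 h) (G1 k).
Proof.
apply: Ffaithful; rewrite fmorM !FG1 -!cmpA; congr (cmp _ (cmp _ _)).
by rewrite (cmpA (e Y)) eK cmp1m.
Qed.

Let G : functor D C := Functor (FunctorOn G1_idm G1_cmp).

Lemma fully_faithful_equivalence : is_equivalence F.
Proof.
exists G; split; last first.
  exists e; split=> [|X Y h /=]; first exact: eP.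
  by rewrite FG1 cmpA eK cmp1m.
have eta A : exists a : Hom (G0 (F A)) A, fmor F a = e (F A) by exact: Ffull.
have [eta' etaP] := all_sig (fun A => cid (eta A)).
exists eta'; split=> [A|A B f].
  have [b bE] := Ffull (ei (F A)).
  by exists b; split; apply: Ffaithful; rewrite fmorM fmor1 bE etaP ?eiK ?eK.
by apply: Ffaithful; rewrite /= !fmorM !etaP FG1 cmpA eK cmp1m.
Qed.

End equivalence.

Section extended_image.
Context {U V : category} (F : functor U V).
Hypotheses (Ffaithful : faithful F) (Ffull : full_on_isos F).

Definition image_obj (X : V) : Prop :=
  exists (A : U) (a : Hom (F A) X), is_iso a.

(** The arrows f that are isomorphic, as arrows, to an arrow of the form F u. *)
Definition image_hom (X Y : V) (f : Hom X Y) : Prop :=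
  exists (A B : U) (a : Hom (F A) X) (b : Hom (F B) Y) (u : Hom A B),
    [/\ is_iso a, is_iso b & cmp f a = cmp b (fmor F u)].

Lemma image_hom_ends (X Y : V) (f : Hom X Y) :
  image_hom f -> image_obj X /\ image_obj Y.
Proof.
by move=> [A [B [a [b [u [ai bi _]]]]]]; split; [exists A, a|exists B, b].
Qed.

Lemma image_hom_iso (X Y : V) (f : Hom X Y) :
  image_obj X -> is_iso f -> image_hom f.
Proof.
move=> [A [a ai]] fi; exists A, A, a, (cmp f a), (idm A); split=> //.
  exact: is_iso_cmp.
by rewrite fmor1 cmpm1.
Qed.

Lemma image_hom_idm (X : V) : image_obj X -> image_hom (idm X).
Proof. by move=> XI; apply: image_hom_iso => //; exact: is_iso_idm. Qed.

(** The isomorphism from F B to F A' which compares the two descriptions of the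
    middle object Y is itself of the form F w, by fullness on isomorphisms. *)
Lemma image_hom_cmp (X Y Z : V) (g : Hom Y Z) (f : Hom X Y) :
  image_hom g -> image_hom f -> image_hom (cmp g f).
Proof.
move=> [A' [B' [a' [b' [v [[a'i [a'K Ka']] b'i ga']]]]]].
move=> [A [B [a [b [u [ai bi fa]]]]]].
have [|w wE] := @Ffull _ _ (cmp a'i b).
  by apply: is_iso_cmp => //; exists a'.
exists A, B', a, b', (cmp v (cmp w u)); split=> //.
rewrite -cmpA fa !fmorM wE (cmpA b') -ga' -!cmpA; congr cmp.
by rewrite !cmpA Ka' cmp1m.
Qed.

Definition image_subcategory : subcategory V :=
  Subcategory image_hom_ends image_hom_idm image_hom_cmp.

Lemma factors_through_image : factors_through F image_subcategory.
Proof.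
split=> [A|A B f]; first by exists A, (idm (F A)); exact: is_iso_idm.
exists A, B, (idm _), (idm _), f.
by split; [exact: is_iso_idm|exact: is_iso_idm|rewrite cmp1m cmpm1].
Qed.

Lemma extended_image_subcategory : is_extended_image F image_subcategory.
Proof.
split; [exact: image_hom_iso|exact: factors_through_image|].
move=> T Tiso [TF TFm].
have Tobj X (A : U) (a : Hom (F A) X) : is_iso a -> sub_hom T a.
  by apply: Tiso; exact: TF.
split=> [X [A [a ai]]|X Y f [A [B [a [b [u [[a' [a'K aK]] bi fa]]]]]]].
  by have [] := sub_ends (Tobj _ _ _ ai).
have TX : sub_obj T X.
  by have [] := @sub_ends _ T _ _ a (Tobj _ _ _ (ex_intro _ a' (conj a'K aK))).
have -> : f = cmp (cmp b (fmor F u)) a' by rewrite -fa -cmpA aK cmpm1.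
apply: sub_cmp; last by apply: Tiso => //; exists a.
by apply: sub_cmp => //; exact: Tobj.
Qed.

(** Fullness on isomorphisms makes the corestriction full: an arrow between two
    objects F A and F B differs from an arrow F u by isomorphisms between
    objects in the image. *)
Lemma corestriction_equivalence :
  is_equivalence (corestriction factors_through_image).
Proof.
apply: fully_faithful_equivalence.
- by move=> A B f g /(congr1 sval) /Ffaithful.
- move=> A B [f [A' [B' [a [b [u [[a' [a'K aK]] bi fa]]]]]]].
  have [a1 a1E] : exists a1 : Hom A A', fmor F a1 = a'.
    by apply: Ffull; exists a.
  have [b1 b1E] := Ffull bi.
  exists (cmp b1 (cmp u a1)); apply: sig_Prop_eq => /=.
  by rewrite !fmorM a1E b1E cmpA -fa -cmpA aK cmpm1.
- move=> [X XI]; have [A [a [a' [a'K aK]]]] := XI.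
  have Sa : image_hom a.
    by apply: image_hom_iso; [exact: factors_through_image.1|exists a'].
  have Sa' : image_hom a' by apply: image_hom_iso => //; exists a.
  by exists A, (exist _ a Sa), (exist _ a' Sa'); split; exact: sig_Prop_eq.
Qed.

End extended_image.

(** * The functor and the duality *)

Section refinable_isomorphism.
Context {X Y : ptop} (h : ptmap X Y) (g : ptmap Y X).
Hypotheses (hK : cancel h g) (gK : cancel g h).

Lemma clopen_upper_preimage (Z W : ptop) (f : ptmap Z W) (U : set W) :
  clopen_upper U -> clopen_upper (f @^-1` U).
Proof.
move=> [[Uo Uc] Uup]; split; last first.
  by move=> x y xy; apply: Uup; exact: ptmap_mono.
split; first by apply: open_comp => // x _; exact: ptmap_cont.
by apply: closed_comp => // x _; exact: ptmap_cont.
Qed.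

Lemma clopen_upper_refinable_preimage (U : set Y) :
  clopen_upper_refinable U -> clopen_upper_refinable (h @^-1` U).
Proof.
move=> Uref C Ccu CU.
have [||R [Rcu Rd RU RC]] := Uref [set g @^-1` V | V in C].
- by move=> _ [V CV <-]; apply: clopen_upper_preimage; exact: Ccu.
- rewrite bigcup_image -preimage_bigcup CU.
  by apply/seteqP; split=> y /=; rewrite gK.
exists [set h @^-1` W | W in R]; split.
- by move=> _ [W RW <-]; apply: clopen_upper_preimage; exact: Rcu.
- move=> _ _ [W RW <-] [W' RW' <-] [x [Wx W'x]]; congr (h @^-1` _).
  by apply: Rd => //; exists (h x).
- by rewrite bigcup_image -preimage_bigcup RU.
- move=> _ [W RW <-]; have [_ [V CV <-] WV] := RC W RW.
  by exists V => // x /WV; rewrite /= hK.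
Qed.

End refinable_isomorphism.

Section dual_functor.

Lemma is_dfilter_preimage (D E : djlat) (f : djhom D E) (F : dfilter E) :
  is_dfilter (f @^-1` F).
Proof.
have [f1 fI fj] := djhomP f; have [[F1 FI Fup] Fd] := dfilterP F.
have fle x y : (x <= y -> f x <= f y)%O.
  by move=> /meet_idPl xy; apply/meet_idPl; rewrite -fI xy.
split; first split=> [|x y Fx Fy|x y xy] /=.
- by rewrite f1.
- by rewrite fI; exact: FI.
- by apply: Fup; exact: fle.
move=> n b j bd bj Fj; apply: Fd (fj n b j bd bj) Fj => i k ik /=.
by rewrite -fI bd// disjunctive_hom_bot.
Qed.

Definition dfilter_preimage (D E : djlat) (f : djhom D E) (F : dfilter E) :
  dfilter D := DFilter (is_dfilter_preimage f F).

Lemma dfilter_preimage_continuous (D E : djlat) (f : djhom D E) :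
  continuous (dfilter_preimage f).
Proof.
by apply: continuous_dfilter => x; exact: (clopen_dfilters_at (f x)).
Qed.

Definition Pmap (D E : djlat) (f : djhom D E) : ptmap (Pspace E) (Pspace D) :=
  @PTMap (Pspace E) (Pspace D) (dfilter_preimage f)
    (@dfilter_preimage_continuous D E f) (fun F G FG x => FG (f x)).

Lemma Pmap_id (D : djlat) : Pmap (djid D) = ptid (Pspace D).
Proof. by apply: ptmap_eq => F; exact: dfilter_eq. Qed.

Lemma Pmap_cmp (D E K : djlat) (g : djhom E K) (f : djhom D E) :
  Pmap (djcmp g f) = ptcmp (Pmap f) (Pmap g).
Proof. by apply: ptmap_eq => F; exact: dfilter_eq. Qed.

Definition Pfunctor_on : @functor_on (opcat DJLatCat) PTopCat Pspace :=
  @FunctorOn (opcat DJLatCat) PTopCat Pspace (fun D E f => @Pmap E D f)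
    Pmap_id (fun D E K g f => @Pmap_cmp K E D f g).

Definition Pfunctor : functor (opcat DJLatCat) PTopCat := Functor Pfunctor_on.

Lemma Pfunctor_faithful : faithful Pfunctor.
Proof.
move=> D E f g fg; apply: djhom_eq => x.
apply: dfilters_at_inj; apply/funext => F.
exact: (congr1 (fun h : ptmap (Pspace D) (Pspace E) =>
  dfilters_at x (h F : dfilter E)) fg).
Qed.

(** Meets and disjoint joins are computed on the sets of filters, where inverse
    images preserve them. *)
Lemma djhom_of_preimage (D E : djlat) (h : dfilter E -> dfilter D)
    (f : D -> E) :
  (forall x, dfilters_at (f x) = h @^-1` dfilters_at x) -> disjunctive_hom f.
Proof.
move=> fE; split=> [|x y|n b j bd bj].
- by apply: dfilters_at_inj; rewrite fE !dfilters_atT.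
- by apply: dfilters_at_inj; rewrite dfilters_atI !fE dfilters_atI.
apply/is_joinP; split=> [i|z fz].
  apply/sub_dfilters_at => F; rewrite /= !fE; apply: dfilters_at_le.
  by have [+ _] := (is_joinP _ _).1 bj; apply.
apply/sub_dfilters_at; rewrite fE (dfilters_at_join bd bj) => F [i _ hF].
by apply: (dfilters_at_le (fz i)); rewrite fE.
Qed.

(** An isomorphism h of ordered spaces transports refinable clopen upper sets,
    so the inverse image under h of the filters at x consists of the filters at
    some f x. *)
Lemma Pfunctor_full_on_isos : full_on_isos Pfunctor.
Proof.
move=> E D h [g [gh hg]].
have hK : cancel h g by move=> F; exact: (congr1 (fun k : ptmap _ _ => k F) gh).
have gK : cancel g h by move=> F; exact: (congr1 (fun k : ptmap _ _ => k F) hg).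
have fex (x : D) : exists y : E, dfilters_at y = h @^-1` dfilters_at x.
  suff [y _ yE] : range (@dfilters_at E) (h @^-1` dfilters_at x) by exists y.
  rewrite range_dfilters_at; split.
    by apply: clopen_upper_preimage; exact: clopen_upper_dfilters_at.
  apply: (clopen_upper_refinable_preimage hK gK).
  exact: clopen_upper_refinable_dfilters_at.
have [f fE] := choice fex.
exists (DJHom (djhom_of_preimage fE)); apply: ptmap_eq => F.
apply: dfilter_eq; apply/funext => x.
exact: (congr1 (fun A => A F) (fE x)).
Qed.

End dual_functor.

(** * Prime filters of Boolean algebras *)

Section boolean_algebras.
Context {d : Order.disp_t} {B : ctbDistrLatticeType d}.
Implicit Types (x y : B) (G : set B).

Lemma is_join_joins (n : nat) (b : 'I_n -> B) : is_join b (\join_(i < n) b i)%O.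
Proof.
by apply/is_joinP; split=> [i|z bz]; [exact: joins_sup|apply/joinsP => i _].
Qed.

Lemma meet_is_join (n : nat) (b : 'I_n -> B) (j a : B) :
  is_join b j -> is_join (fun i => a `&` b i)%O (a `&` j)%O.
Proof.
have meet_le y z : ((a `&` y <= z) = (y <= ~` a `|` z))%O.
  by rewrite -leBLR diffE complK meetC.
move=> /is_joinP[bj jleast]; apply/is_joinP; split=> [i|z abz].
  by rewrite leI2.
by rewrite meet_le; apply: jleast => i; rewrite -meet_le.
Qed.

Definition boolean_djlat : djlat := @DJLat d B
  (fun n b _ => ex_intro _ _ (is_join_joins b))
  (fun n b j a _ => @meet_is_join n b j a).

Lemma prime_filter_joins (n : nat) (b : 'I_n -> B) (j : B) G :
  is_prime_filter G -> is_join b j -> G j -> exists i, G (b i).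
Proof.
move=> [_ G0 GU] bj; rewrite (is_join_unique bj (is_join_joins b)).
by elim/big_ind: _ => [/G0//|x y xG yG /GU[/xG|/yG]|i _ Gi]//; exists i.
Qed.

Lemma prime_filter_compl x G : is_prime_filter G -> G (~` x)%O <-> ~ G x.
Proof.
move=> [[G1 GI _] G0 GU]; split=> [Gnx Gx|nGx].
  by apply: G0; rewrite -(meetCx x); exact: GI.
by have [|//] : G x \/ G (~` x)%O by apply: GU; rewrite joinxC.
Qed.

Lemma prime_filter_meet x y G :
  is_prime_filter G -> G (x `&` y)%O <-> G x /\ G y.
Proof.
move=> [[_ GI Gup] _ _]; split=> [Gxy|[]]; last exact: GI.
by split; apply: Gup Gxy; [exact: leIl|exact: leIr].
Qed.

Lemma prime_filter_join x y G :
  is_prime_filter G -> G (x `|` y)%O <-> G x \/ G y.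
Proof.
move=> [[_ _ Gup] _ GU]; split=> [/GU//|[]]; apply: Gup.
  exact: leUl.
exact: leUr.
Qed.

(** Every binary join is a disjoint join, of x and the difference of y and x. *)
Lemma dfilter_prime (G : dfilter boolean_djlat) :
  is_prime_filter (dfilter_set G : set B).
Proof.
have [Gfil Gd] := dfilterP G; split=> // [G0|x y Gxy].
  have b0 : @pairwise_disjoint _ boolean_djlat 0 (fun=> \bot%O) by case.
  have [|[]//] := Gd 0 _ _ b0 _ G0.
  by apply/is_joinP; split=> [[]|z _] //; exact: le0x.
pose b (i : 'I_2) : boolean_djlat := if val i == 0 then x else (y `\` x)%O.
have bd : pairwise_disjoint b.
  move=> [[|[|//]] i] [[|[|//]] k] //= _; rewrite /b/= ?diffKI//.
  by rewrite meetC diffKI.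
have bj : is_join b (x `|` y)%O.
  apply/is_joinP; split=> [[[|[|//]] i]|z bz]; rewrite /b/= ?leUl//.
    by rewrite (le_trans (leBx _ _))// leUr.
  by have /= := bz ord0; have /= := bz (lift ord0 ord0);
    rewrite /b/= leBLR leUx => xyz xz; rewrite xz (le_trans xyz)// leUx xz lexx.
have [[[|[|//]] i]] := Gd 2 b _ bd bj Gxy; rewrite /b/=; first by left.
have [_ _ Gup] := Gfil => Gyx; right; apply: Gup Gyx; exact: leBx.
Qed.

Lemma prime_filter_sep x y :
  (forall G, is_prime_filter G -> G x -> G y) -> (x <= y)%O.
Proof.
move=> xy; apply/(@sub_dfilters_at boolean_djlat) => G.
by apply: xy; exact: dfilter_prime.
Qed.

Lemma is_dfilter_prime_preimage (D : djlat) (h : D -> B) G :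
  disjunctive_hom h -> is_prime_filter G -> is_dfilter (h @^-1` G).
Proof.
move=> [h1 hI hj] Gprime; have [[G1 GI Gup] _ _] := Gprime.
split; first split=> [|x y Gx Gy|x y /meet_idPl xy] /=.
- by rewrite h1.
- by rewrite hI; exact: GI.
- by apply: Gup; apply/meet_idPl; rewrite -hI xy.
by move=> n b j bd bj Gj; apply: prime_filter_joins Gprime (hj n b j bd bj) Gj.
Qed.

End boolean_algebras.

Lemma boolean_hom_prime_preimage (d d' : Order.disp_t)
    (B : ctbDistrLatticeType d) (B' : ctbDistrLatticeType d') (g : B -> B')
    (G : set B') :
  is_boolean_hom g -> is_prime_filter G -> is_prime_filter (g @^-1` G).
Proof.
move=> [g0 g1 gI gU] [[G1 GI Gup] G0 GU].
split=> [||x y] /=; [|by rewrite g0|by rewrite gU => /GU].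
split=> [|x y|x y /meet_idPl xy] /=; first by rewrite g1.
  by rewrite gI; exact: GI.
by apply: Gup; apply/meet_idPl; rewrite -gI xy.
Qed.

Lemma boolean_hom_comp (d d' d'' : Order.disp_t)
    (B : ctbDistrLatticeType d) (B' : ctbDistrLatticeType d')
    (B'' : ctbDistrLatticeType d'') (g : B' -> B'') (f : B -> B') :
  is_boolean_hom g -> is_boolean_hom f -> is_boolean_hom (g \o f).
Proof.
move=> [g0 g1 gI gU] [f0 f1 fI fU].
by split=> [||x y|x y] /=; rewrite ?f0 ?f1 ?fI ?fU.
Qed.

Lemma prime_filter_true : is_prime_filter (fun b : bool => b : Prop).
Proof. by split=> [|//|[] []]; [split=> [|[] []|[] []]|left|left|right|]. Qed.

Lemma dfilter_bool_hom (D : djlat) (F : dfilter D) :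
  disjunctive_hom (fun x => `[< dfilters_at x F >]).
Proof.
have FT : dfilters_at \top%O F by rewrite dfilters_atT.
split=> [|x y|n b j bd bj]; first exact/asboolP.
  by rewrite dfilters_atI; exact: asbool_and.
have leb (x y : bool) : (x <= y)%O <-> (x -> y).
  by case: x; case: y; split=> // /(_ isT).
apply/is_joinP; split=> [i|z bz].
  apply/leb => /asboolP Fi; apply/asboolP.
  by apply: dfilters_at_le Fi; have [+ _] := (is_joinP _ _).1 bj; apply.
apply/leb => /asboolP; rewrite (dfilters_at_join bd bj) => -[i _ Fi].
by apply: (leb _ _).1 (bz i) _; exact/asboolP.
Qed.

(** * The free Boolean algebra as an algebra of sets *)

Section spectral_representation.
Context {D : djlat} {d : Order.disp_t} {B : ctbDistrLatticeType d}.
Context (h : D -> B).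
Implicit Types (U V : set (dfilter D)) (b c : B).

(** The prime filters containing b are those whose inverse image along h lies
    in U. *)
Definition represents b U : Prop :=
  forall (G : set B) (F : dfilter D), is_prime_filter G ->
    h @^-1` G = dfilter_set F -> G b <-> U F.

Hypothesis hhom : disjunctive_hom h.

Lemma represents_le b c U V :
  represents b U -> represents c V -> U `<=` V -> (b <= c)%O.
Proof.
move=> bU cV UV; apply: prime_filter_sep => G Gp.
pose F := DFilter (is_dfilter_prime_preimage hhom Gp).
by move=> /(bU G F Gp erefl)/UV/(cV G F Gp erefl).
Qed.

Lemma represents_unique b c U :
  represents b U -> represents c U -> b = c.
Proof.
move=> bU cU; apply/eqP; rewrite eq_le.
by rewrite (represents_le bU cU)// (represents_le cU bU).
Qed.

Lemma represents_dfilters_at x : represents (h x) (dfilters_at x).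
Proof. by move=> G F _ GF; rewrite /dfilters_at/= -GF. Qed.

Lemma represents_setC b U : represents b U -> represents (~` b)%O (~` U).
Proof.
by move=> bU G F Gp GF; rewrite prime_filter_compl// (bU G F Gp GF).
Qed.

Lemma represents_setI b c U V :
  represents b U -> represents c V -> represents (b `&` c)%O (U `&` V).
Proof.
move=> bU cV G F Gp GF.
by rewrite prime_filter_meet// (bU G F Gp GF) (cV G F Gp GF).
Qed.

Lemma represents_setU b c U V :
  represents b U -> represents c V -> represents (b `|` c)%O (U `|` V).
Proof.
move=> bU cV G F Gp GF.
by rewrite prime_filter_join// (bU G F Gp GF) (cV G F Gp GF).
Qed.

End spectral_representation.

Section generated_algebra.
Context {D : djlat}.

Inductive generated : set (dfilter D) -> Prop :=
| generated_at x : generated (dfilters_at x)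
| generated_setC U of generated U : generated (~` U)
| generated_setI U V of generated U & generated V : generated (U `&` V).

Lemma generated_setU U V : generated U -> generated V -> generated (U `|` V).
Proof.
by move=> gU gV; rewrite -[U `|` V]setCK setCU; apply: generated_setC;
  apply: generated_setI; exact: generated_setC.
Qed.

Lemma generated_setT : generated setT.
Proof. by rewrite -dfilters_atT; exact: generated_at. Qed.

Lemma generated_set0 : generated set0.
Proof. by rewrite -dfilters_at0; exact: generated_at. Qed.

Lemma generated_clopen U : generated U -> clopen U.
Proof.
elim=> [x|{}U _|{}U V _ ? _]; [exact: clopen_dfilters_at|exact: clopenC|].
exact: clopenI.
Qed.

End generated_algebra.

Definition generated_algebra (D : djlat) : Type :=
  {U : set (dfilter D) | generated U}.

Section generated_algebra_lattice.
Context {D : djlat}.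
Local Notation T := (generated_algebra D).
Implicit Types (x y z : T).

Definition ga_le x y : bool := `[< sval x `<=` sval y >].
Definition ga_meet x y : T := exist _ _ (generated_setI (svalP x) (svalP y)).
Definition ga_join x y : T := exist _ _ (generated_setU (svalP x) (svalP y)).
Definition ga_compl x : T := exist _ _ (generated_setC (svalP x)).
Definition ga_bot : T := exist _ _ generated_set0.
Definition ga_top : T := exist _ _ generated_setT.

HB.instance Definition _ := gen_eqMixin T.
HB.instance Definition _ := gen_choiceMixin T.

Lemma ga_le_def x y : ga_le x y = (ga_meet x y == x).
Proof.
apply/asboolP/eqP => [/setIidPl xy|/(congr1 sval)/setIidPl//].
exact: sig_Prop_eq.
Qed.

Let ga_meetC : commutative ga_meet.
Proof. by move=> x y; apply: sig_Prop_eq; exact: setIC. Qed.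

Let ga_joinC : commutative ga_join.
Proof. by move=> x y; apply: sig_Prop_eq; exact: setUC. Qed.

Let ga_meetA : associative ga_meet.
Proof. by move=> x y z; apply: sig_Prop_eq; exact: setIA. Qed.

Let ga_joinA : associative ga_join.
Proof. by move=> x y z; apply: sig_Prop_eq; exact: setUA. Qed.

Let ga_joinKI y x : ga_meet x (ga_join x y) = x.
Proof. by apply: sig_Prop_eq; rewrite /= setUC setKU. Qed.

Let ga_meetKU y x : ga_join x (ga_meet x y) = x.
Proof. by apply: sig_Prop_eq; rewrite /= setIC setKI. Qed.

Let ga_meetUl : left_distributive ga_meet ga_join.
Proof. by move=> x y z; apply: sig_Prop_eq; exact: setIUl. Qed.

Let ga_meetxx : idempotent_op ga_meet.
Proof. by move=> x; apply: sig_Prop_eq; exact: setIid. Qed.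

HB.instance Definition _ := Order.isMeetJoinDistrLattice.Build set_display T
  ga_le_def (fun _ _ => erefl) ga_meetC ga_joinC ga_meetA ga_joinA
  ga_joinKI ga_meetKU ga_meetUl ga_meetxx.

Lemma ga_leP x y : reflect (sval x `<=` sval y) (x <= y)%O.
Proof. exact: asboolP. Qed.

Let ga_le0x x : (ga_bot <= x)%O.
Proof. by apply/ga_leP; exact: sub0set. Qed.

Let ga_lex1 x : (x <= ga_top)%O.
Proof. by apply/ga_leP; exact: subsetT. Qed.

HB.instance Definition _ := Order.hasBottom.Build set_display T ga_le0x.
HB.instance Definition _ := Order.hasTop.Build set_display T ga_lex1.

Let ga_joinxC x : (x `|` ga_compl x = \top)%O.
Proof. by apply: sig_Prop_eq; exact: setUv. Qed.

Let ga_meetxC x : (x `&` ga_compl x = \bot)%O.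
Proof. by apply: sig_Prop_eq; exact: setICr. Qed.

HB.instance Definition _ :=
  Order.TBDistrLattice_hasComplement.Build set_display T ga_joinxC ga_meetxC.

End generated_algebra_lattice.

Section generated_algebra_free.
Context {D : djlat}.

Definition ga_at (x : D) : generated_algebra D := exist _ _ (generated_at x).

Lemma disjunctive_ga_at : disjunctive_hom ga_at.
Proof.
split=> [|x y|n b j bd bj]; first by apply: sig_Prop_eq; exact: dfilters_atT.
  by apply: sig_Prop_eq; exact: dfilters_atI.
apply/is_joinP; split=> [i|z bz] /=.
  by apply/ga_leP => F; apply: dfilters_at_le;
    have [+ _] := (is_joinP _ _).1 bj; apply.
apply/ga_leP; rewrite /= (dfilters_at_join bd bj) => F [i _].
by have /ga_leP := bz i; apply.
Qed.

Lemma generated_represented (d : Order.disp_t) (B : ctbDistrLatticeType d)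
    (h : D -> B) (U : set (dfilter D)) :
  generated U -> exists b, represents h b U.
Proof.
elim=> [x|{}U _ [b bU]|{}U V _ [b bU] _ [c cV]].
- by exists (h x); exact: represents_dfilters_at.
- by exists (~` b)%O; exact: represents_setC.
- by exists (b `&` c)%O; exact: represents_setI.
Qed.

(** Hence a Boolean homomorphism out of the generated algebra is determined by
    its restriction to the lattice. *)
Lemma boolean_hom_represents (d : Order.disp_t) (B : ctbDistrLatticeType d)
    (k : generated_algebra D -> B) (a : generated_algebra D) :
  is_boolean_hom k -> represents (k \o ga_at) (k a) (sval a).
Proof.
move=> khom G F Gp GF; have kGp := boolean_hom_prime_preimage khom Gp.
case: a => U gU /=; have gU' := gU.
elim: U / gU' gU => [x|V gV IH|V W gV IHV gW IHW] gU.
- have -> : exist _ _ gU = ga_at x by exact: sig_Prop_eq.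
  exact: (represents_dfilters_at x Gp GF).
- have -> : exist _ _ gU = ga_compl (exist _ V gV) by exact: sig_Prop_eq.
  pose x : generated_algebra D := exist _ V gV.
  apply: iff_trans (prime_filter_compl x kGp) _.
  by split=> nV /(IH gV).
- have -> : exist _ _ gU = ga_meet (exist _ V gV) (exist _ W gW).
    exact: sig_Prop_eq.
  pose x : generated_algebra D := exist _ V gV.
  pose y : generated_algebra D := exist _ W gW.
  apply: iff_trans (prime_filter_meet x y kGp) _.
  by split=> -[/(IHV gV) VF /(IHW gW) WF].
Qed.

(** The extension of h sends a generated set to the element that represents it
    along h. *)
Lemma generated_algebra_free : is_free_boolean ga_at.
Proof.
split; first exact: disjunctive_ga_at.
move=> d B h hhom.
have [g gP] := choice (fun a : generated_algebra D =>
  generated_represented h (svalP a)).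
exists g; split.
  split; last by move=> x; apply: (represents_unique hhom (gP _));
    exact: represents_dfilters_at.
  split=> [||a b|a b]; apply: (represents_unique hhom (gP _)).
  - by move=> G F [_ G0 _] _; split.
  - by move=> G F [[G1 _ _] _ _] _; split.
  - exact: represents_setI.
  - exact: represents_setU.
move=> k [khom /funext kat]; apply/funext => a.
apply: (represents_unique hhom (gP a)).
by rewrite -kat; exact: boolean_hom_represents.
Qed.

End generated_algebra_free.

(** * Recovering the lattice from a free Boolean algebra *)

Lemma clopen_upper_finite_cover (D : djlat) (U : set (Pspace D)) :
  clopen_upper U ->
  exists (n : nat) (x : 'I_n -> D), U = \bigcup_i dfilters_at (x i).
Proof.
move=> Ucu; have [[Uo Uc] _] := Ucu.
have : compact U by exact: subclosed_compact (@compact_Pspace D) _.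
move=> /compact_finite_subcover/(_ D [set x | dfilters_at x `<=` U]
  (@dfilters_at D)).
case=> [x _|F UF|E EU UE]; first by have [] := clopen_dfilters_at x.
  by have [x Fx xU] := clopen_upper_basis Ucu UF; exists x.
pose x (i : 'I_#|{: E}|) : D := val (enum_val i).
exists #|{: E}|, x; rewrite eqEsubset; split=> [F /UE [y Ey yF]|F [i _]].
  by exists (enum_rank (FSetSub Ey)) => //; rewrite /x enum_rankK.
by have := EU _ (valP (enum_val i)); rewrite inE; apply.
Qed.

Section free_boolean_algebra.
Context {D : djlat} {d : Order.disp_t} {B : ctbDistrLatticeType d}.
Context {u : D -> B} (ufree : is_free_boolean u).
Implicit Types (G : set B) (F : dfilter D) (U V : set (dfilter D)) (b c : B).

Lemma free_boolean_hom_unique (d' : Order.disp_t) (B' : ctbDistrLatticeType d')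
    (g k : B -> B') :
  is_boolean_hom g -> is_boolean_hom k -> disjunctive_hom (g \o u) ->
  (forall x, k (u x) = g (u x)) -> g = k.
Proof.
move=> ghom khom guhom ku.
have [l [_ lunique]] := ufree.2 _ _ _ guhom.
by rewrite -(lunique g)// -(lunique k).
Qed.

(** A disjunctive filter is a disjunctive homomorphism to the two-element
    Boolean algebra, and a prime filter a Boolean homomorphism to it. *)
Lemma prime_filter_of_dfilter F :
  exists2 G, is_prime_filter G & u @^-1` G = dfilter_set F.
Proof.
have [g [[ghom gu] _]] := ufree.2 _ _ _ (dfilter_bool_hom F).
exists (g @^-1` (fun b : bool => b : Prop)).
  exact: boolean_hom_prime_preimage ghom prime_filter_true.
by apply/funext => x /=; rewrite gu asboolE.
Qed.

(** b is the image of a generated set under the comparison k from the generated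
    algebra, and that set represents it. *)
Lemma free_boolean_represented b :
  exists U, clopen U /\ represents u b U.
Proof.
have [uhom _] := ufree.
have [g [[ghom gu] _]] := ufree.2 _ _ _ (@disjunctive_ga_at D).
have [k [[khom ku] _]] := (@generated_algebra_free D).2 _ _ _ uhom.
have kg : k \o g = id.
  apply: free_boolean_hom_unique => //; first exact: boolean_hom_comp.
    suff -> : (k \o g) \o u = u by [].
    by apply/funext => x /=; rewrite gu ku.
  by move=> x /=; rewrite gu ku.
exists (sval (g b)); split; first exact: generated_clopen (svalP (g b)).
have <- : k \o ga_at = u by exact/funext.
by rewrite -[X in represents _ X]/(id b) -kg; exact: boolean_hom_represents.
Qed.

Lemma prime_filter_restriction_bij :
  set_bij (@is_prime_filter d B) (@is_dfilter _ D) (fun G => u @^-1` G).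
Proof.
split=> [G Gp|G G' /set_mem Gp /set_mem G'p GG'|F Fd].
- exact: is_dfilter_prime_preimage ufree.1 Gp.
- apply/funext => b; apply/propext.
  have [U [_ bU]] := free_boolean_represented b.
  pose F := DFilter (is_dfilter_prime_preimage ufree.1 Gp).
  by rewrite (bU G F Gp erefl) (bU G' F G'p (esym GG')).
- by have [G Gp GF] := prime_filter_of_dfilter (DFilter Fd); exists G.
Qed.

Lemma represents_subset b c U V :
  represents u b U -> represents u c V -> (b <= c)%O <-> U `<=` V.
Proof.
move=> bU cV; split; last exact: (represents_le ufree.1 bU cV).
move=> bc F.
have [G Gp GF] := prime_filter_of_dfilter F.
rewrite -(bU G F Gp GF) -(cV G F Gp GF).
by have [[_ _ Gup] _ _] := Gp; exact: Gup.
Qed.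

Lemma free_boolean_le (x y : D) : (u x <= u y)%O <-> (x <= y)%O.
Proof.
apply: iff_trans (sub_dfilters_at x y).
exact: represents_subset (represents_dfilters_at _) (represents_dfilters_at _).
Qed.

Lemma represents_disjoint b c U V :
  represents u b U -> represents u c V ->
  (b `&` c = \bot)%O -> U `&` V = set0.
Proof.
move=> bU cV bc; rewrite -subset0 => F.
have [G Gp GF] := prime_filter_of_dfilter F.
have [_ G0 _] := Gp; rewrite -(represents_setI bU cV Gp GF) bc.
exact: G0.
Qed.

Lemma represents_joins (n : nat) (c : 'I_n -> B) (U : 'I_n -> set (dfilter D)) :
  (forall i, represents u (c i) (U i)) ->
  represents u (\join_(i < n) c i)%O (\bigcup_i U i).
Proof.
move=> cU G F Gp GF; split=> [|[i _ /(cU i G F Gp GF) Gi]].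
  move=> /(prime_filter_joins Gp (is_join_joins c))[i /(cU i G F Gp GF) Ui].
  by exists i.
by have [[_ _ Gup] _ _] := Gp; apply: Gup Gi; exact: joins_sup.
Qed.

Lemma upper_element_represents b U :
  represents u b U -> upper_element u b <->
  (forall F F' : dfilter D, dfilter_set F `<=` dfilter_set F' -> U F -> U F').
Proof.
move=> bU; split=> [bup F F' FF'|Uup G G' Gp G'p GG'].
  have [G Gp GF] := prime_filter_of_dfilter F.
  have [G' G'p GF'] := prime_filter_of_dfilter F'.
  rewrite -(bU G F Gp GF) -(bU G' F' G'p GF').
  by apply: bup => //; rewrite GF GF'.
pose F := DFilter (is_dfilter_prime_preimage ufree.1 Gp).
pose F' := DFilter (is_dfilter_prime_preimage ufree.1 G'p).
by rewrite (bU G F Gp erefl) (bU G' F' G'p erefl); exact: Uup.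
Qed.

Lemma upper_element_clopen b U :
  represents u b U -> clopen U -> upper_element u b ->
  @clopen_upper (Pspace D) U.
Proof.
by move=> bU Uc bup; split=> //; exact/(upper_element_represents bU).
Qed.

Lemma upper_element_unit (x : D) : upper_element u (u x).
Proof. by move=> G G' _ _; apply. Qed.

Lemma upper_refinable_unit (x : D) : upper_refinable u (u x).
Proof.
move=> n c cup cx.
have [U cU] := choice (fun i => free_boolean_represented (c i)).
have xU : dfilters_at x = \bigcup_i U i.
  have cjU := represents_joins (fun i => (cU i).2).
  rewrite cx in cjU; have xx := @represents_dfilters_at D _ B u x.
  by rewrite eqEsubset; split; [apply/(represents_subset xx cjU)
                               |apply/(represents_subset cjU xx)].
have [F|m [b [bd bj bV]]] := @disjoint_refinement _
    [set a : D | exists i, dfilters_at a `<=` U i] x.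
  rewrite xU => -[i _ UF]; have [Uc ciU] := cU i.
  have [a Fa aU] := clopen_upper_basis (upper_element_clopen ciU Uc (cup i)) UF.
  by exists a => //; exists i.
have [_ uI uj] := ufree.1.
exists m, (u \o b); split.
- by move=> k; exact: upper_element_unit.
- move=> i k ik /=; rewrite -uI bd//.
  exact: (disjunctive_hom_bot (@DJHom D (@boolean_djlat d B) u ufree.1)).
- exact: is_join_unique (is_join_joins _) (uj m b x bd bj).
- move=> k; have [a [i aU] ba] := bV k; exists i.
  apply/(represents_subset (represents_dfilters_at _) (cU i).2).
  by apply: subset_trans aU; exact/sub_dfilters_at.
Qed.

(** As for clopen upper sets, refinability is applied to a covering by basic
    elements; here a finite one is needed, provided by compactness. *)
Lemma range_free_boolean :
  range u = [set b : B | upper_element u b /\ upper_refinable u b].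
Proof.
rewrite eqEsubset; split=> [_ [x _ <-]|b [bup bref]].
  by split; [exact: upper_element_unit|exact: upper_refinable_unit].
have [U [Uc bU]] := free_boolean_represented b.
have Ucu := upper_element_clopen bU Uc bup.
have [n [x Ux]] := clopen_upper_finite_cover Ucu.
have bx : (\join_(i < n) u (x i))%O = b.
  apply: (represents_unique ufree.1 _ bU); rewrite Ux.
  by apply: represents_joins => i; exact: represents_dfilters_at.
have [m [r [rup rd rb rx]]] := bref n _ (fun i => @upper_element_unit (x i)) bx.
have [W rW] := choice (fun k => free_boolean_represented (r k)).
have UW : \bigcup_k W k = U.
  have rjW := represents_joins (fun k => (rW k).2); rewrite rb in rjW.
  by rewrite eqEsubset; split; [apply/(represents_subset rjW bU)
                               |apply/(represents_subset bU rjW)].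
have Wd : trivIset (range W) id.
  move=> _ _ [i _ <-] [k _ <-] /= [F WF]; have [->//|ik] := eqVneq i k.
  have := represents_disjoint (rW i).2 (rW k).2 (rd i k ik).
  by move=> /(congr1 (fun A => A F)) WF0; have : set0 F by rewrite -WF0.
have Wcu V : range W V -> @clopen_upper (Pspace D) V.
  by move=> [k _ <-]; have [Wc kW] := rW k; exact: upper_element_clopen kW Wc _.
have [||y yU] := @dfilters_at_disjoint_bigcup D U (range W) Uc Wd.
- by rewrite bigcup_image.
- move=> V WV; have [k _ kV] := WV; have [i ri] := rx k.
  have Vi : V `<=` dfilters_at (x i).
    rewrite -kV; apply/(represents_subset (rW k).2 (represents_dfilters_at _)).
    exact: ri.
  apply: dfilters_at_summand Vi; first exact: Wcu.
  apply: clopen_upper_setD_disjoint WV _ => //.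
  by rewrite bigcup_image UW Ux => F xF; exists i.
exists y => //; apply: (represents_unique ufree.1 _ bU).
by rewrite -yU; exact: represents_dfilters_at.
Qed.

End free_boolean_algebra.

Theorem mainTheorem5 :
  exists P : @functor_on (opcat DJLatCat) PTopCat Pspace,
  [/\ forall (D D' : djlat) (f : djhom D D') (F : dfilter D'),
        (@fmor (opcat DJLatCat) PTopCat Pspace P D' D f F : dfilter D)
          = f @^-1` F :> set D,
      forall D : djlat, priestley (Pspace D),
      exists (S : subcategory PTopCat) (PS : factors_through (Functor P) S),
        is_extended_image (Functor P) S /\ is_equivalence (corestriction PS),
      forall D : djlat,
        [/\ disjunctive_hom (@dfilters_at D),
            forall x y : D, dfilters_at x `<=` dfilters_at y <-> (x <= y)%O &
            range (@dfilters_at D) =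
              [set U : set (Pspace D) |
                 clopen_upper U /\ clopen_upper_refinable U]] &
      forall D : djlat,
        (exists (d : Order.disp_t) (B : ctbDistrLatticeType d) (u : D -> B),
           is_free_boolean u) /\
        (forall (d : Order.disp_t) (B : ctbDistrLatticeType d) (u : D -> B),
           is_free_boolean u ->
           [/\ set_bij (@is_prime_filter d B) (@is_dfilter _ D)
                 (fun G => u @^-1` G),
               forall x y : D, (u x <= u y)%O <-> (x <= y)%O &
               range u =
                 [set b : B | upper_element u b /\ upper_refinable u b]])].
Proof.
exists Pfunctor_on; split=> [//||||].
- exact: @priestley_Pspace.
- exists (image_subcategory Pfunctor_full_on_isos).
  exists (factors_through_image Pfunctor_full_on_isos).
  split; first exact: extended_image_subcategory.
  exact: corestriction_equivalence Pfunctor_faithful _.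
- move=> D; split; [exact: disjunctive_dfilters_at|exact: sub_dfilters_at|].
  exact: range_dfilters_at.
- move=> D; split=> [|d B u ufree].
    exists set_display, (generated_algebra D), ga_at.
    exact: generated_algebra_free.
  split; [exact: prime_filter_restriction_bij|exact: free_boolean_le|].
  exact: range_free_boolean.
Qed.
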